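(* The $G$-orbits of elements of rank two in $M(n,1)$ are in one-one correspondence with the conjugacy classes of derangements of $\{1,\dots,n\}$ in $S_n$. Explicitly, every rank-two element of $M(n,1)$ lies in the orbit of $I+P_\sigma$ for some derangement $\sigma$, and for derangements $\sigma,\tau$ the matrices $I+P_\sigma$ and $I+P_\tau$ lie in the same $G$-orbit if and only if $\sigma$ and $\tau$ are conjugate in $S_n$.
   Context: $M(n,1)$ is the set of $n\times n$ matrices with entries in $\{0,1\}$ whose row and column sums all equal a common value $\rho(M)$, called the rank (line sum) of $M$. $P_\sigma$ is the permutation matrix of $\sigma\in S_n$ with $P_\sigma P_\tau=P_{\sigma\tau}$, and $I$ is the identity matrix. $G$ is the group of order $2(n!)^2$ of transformations of $n\times n$ matrices consisting of the maps $M\mapsto P_\sigma M P_\tau^{-1}$ and $M\mapsto P_\sigma M^T P_\tau^{-1}$ for $\sigma,\tau\in S_n$ (generated by row permutations, column permutations and transpose). A derangement is a permutation with no fixed points. *)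

(* Defs.v *)
From mathcomp Require Import all_boot all_order all_fingroup all_algebra.
From mathcomp Require Import all_classical.

Set Implicit Arguments.
Unset Strict Implicit.
Unset Printing Implicit Defensive.

Import GRing.Theory.
Local Open Scope classical_set_scope.
Local Open Scope ring_scope.

Definition has_line_sum (n : nat) (M : 'M[int]_n) (r : int) : Prop :=
  (forall i, \sum_j M i j = r) /\ (forall j, \sum_i M i j = r).

(* M(n,1) *)
Definition zero_one_magic (n : nat) : set 'M[int]_n :=
  [set M : 'M[int]_n | (forall i j, M i j = 0 \/ M i j = 1) /\
           exists r, has_line_sum M r].

(* The "rank" of an element of M(n,1) is its common line sum, not \rank.
   For n = 0 every r is a line sum, so the empty matrix is in this set. *)
Definition rank_two (n : nat) : set 'M[int]_n :=
  [set M : 'M[int]_n | zero_one_magic M /\ has_line_sum M 2].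

(* [perm_mx] is multiplicative ([perm_mxM]) for the product of 'S_n, in which
   s * t applies s first. *)
Definition line_transf (n : nat) (s t : 'S_n) (M : 'M[int]_n) : 'M[int]_n :=
  perm_mx s *m M *m invmx (perm_mx t).

Definition line_transf_tr (n : nat) (s t : 'S_n) (M : 'M[int]_n) :
    'M[int]_n :=
  perm_mx s *m M^T *m invmx (perm_mx t).

Definition Ggroup (n : nat) : set ('M[int]_n -> 'M[int]_n) :=
  [set g | exists s t : 'S_n, g = line_transf s t \/ g = line_transf_tr s t].

Definition Gorbit (n : nat) (M : 'M[int]_n) : set 'M[int]_n :=
  [set g M | g in @Ggroup n].

Definition rank_two_orbits (n : nat) : set (set 'M[int]_n) :=
  [set Gorbit M | M in @rank_two n].

Definition derangement (n : nat) (s : 'S_n) : Prop := forall i, s i <> i.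

Definition conj_class (n : nat) (s : 'S_n) : {set 'S_n} :=
  (s ^: [set: 'S_n]%SET)%g.

Definition derangement_classes (n : nat) : set {set 'S_n} :=
  [set conj_class s | s in @derangement n].

Definition IplusP (n : nat) (s : 'S_n) : 'M[int]_n := 1%:M + perm_mx s.

(* Main.v *)
(* Pairing the two ones of each row and the two ones of each column gives two
   involutions on the ones of a rank-two matrix M; the ones can be 2-coloured so
   that both involutions switch colours, which splits M as P_a + P_b, and M is
   in the orbit of I + P_(a^-1 b). Such a splitting is unique up to switching
   colours on connected components, and for I + P_s this only inverts some of
   the cycles of s; the resulting permutation has the same orbits as s and is
   therefore conjugate to s. *)
Require Import Defs.
From mathcomp Require Import all_boot all_order all_fingroup all_algebra.
From mathcomp Require Import all_classical.

Set Implicit Arguments.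
Unset Strict Implicit.
Unset Printing Implicit Defensive.

Import GRing.Theory Num.Theory.

(** * Cycles of permutations, and two-colourings from pairs of involutions *)

Section Permutations.
Local Open Scope group_scope.
Variable T : finType.
Implicit Types (s t h v : {perm T}) (x y : T).

(** Coincidences of powers at [x] depend only on the length of the orbit, so they carry over to any
    permutation with the same orbits. *)
Lemma permX_eq_mod s x k l :
  ((s ^+ k) x == (s ^+ l) x) = (k == l %[mod #|porbit s x|]).
Proof.
set m := #|porbit s x|.
have m_gt0 : (0 < m)%N by rewrite lt0n card_porbit_neq0.
have perX q : (s ^+ (q * m)) x = x.
  elim: q => [|q IH]; first by rewrite perm1.
  by rewrite mulSn expgD permM [X in (s ^+ (q * m)) X]permX iter_porbit.
have red i : (s ^+ i) x = nth x (traject s x m) (i %% m).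
  by rewrite nth_traject ?ltn_mod // {1}(divn_eq i m) expgD permM perX permX.
by rewrite !red nth_uniq ?size_traject ?ltn_mod ?uniq_traject_porbit.
Qed.

(* On the orbit of a base point r, the conjugating map is s^k r |-> t^k r. *)
Lemma eq_porbit_conjg s t :
  porbit s =1 porbit t -> t \in s ^: [set: {perm T}]%SET.
Proof.
move=> eq_st.
(* The default [x] is never taken, as [x] lies in its own orbit; so [rep x] depends only on that
   orbit. *)
pose rep x := odflt x [pick y in porbit s x].
have repP x : x \in porbit s (rep x).
  rewrite porbit_sym /rep; case: pickP => //= /(_ x).
  by rewrite porbit_id.
have rep_eq x y : x \in porbit s y -> rep x = rep y.
  rewrite -eq_porbit_mem /rep => /eqP ->.
  by case: pickP => //= /(_ y); rewrite porbit_id.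
have exk x : exists k, x == (s ^+ k) (rep x).
  by have /porbitP[k {1}->] := repP x; exists k.
pose k x := xchoose (exk x).
have kP x : (s ^+ k x) (rep x) = x by rewrite -(eqP (xchooseP (exk x))).
have transfer x i j : (s ^+ i) x = (s ^+ j) x <-> (t ^+ i) x = (t ^+ j) x.
  by split=> /eqP; rewrite permX_eq_mod => H; apply/eqP;
     rewrite permX_eq_mod ?eq_st // -eq_st.
pose phi x := (t ^+ k x) (rep x).
have phi_inj : injective phi.
  move=> x y eq_phi; have rxy : rep x = rep y.
    have in_orb z : phi z \in porbit s (rep z) by rewrite eq_st mem_porbit.
    have rr z : rep (rep z) = rep z by apply/esym/rep_eq.
    by rewrite -rr -(rep_eq _ _ (in_orb x)) eq_phi (rep_eq _ _ (in_orb y)) rr.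
  rewrite -(kP x) -(kP y) rxy; apply/transfer.
  by rewrite -[in LHS]rxy.
have phi_s x : phi (s x) = t (phi x).
  have rs : rep (s x) = rep x by apply: rep_eq; apply: (mem_porbit s 1).
  rewrite /phi rs -permM -expgSr; apply/transfer.
  by rewrite -[in LHS]rs kP expgSr permM kP.
apply/imsetP; exists (perm phi_inj); rewrite ?inE //.
apply/permP => y; rewrite -(permKV (perm phi_inj) y).
by rewrite permJ !permE phi_s.
Qed.

(** [A] is constant on each cycle of [s], so [t] runs through the whole cycle of [x] either forwards
    or backwards. *)
Lemma porbit_eq_or_inv s t x (A : pred T) :
  (forall y, A (s y) = A y) ->
  (forall y, A y -> t y = s y) -> (forall y, ~~ A y -> t y = s^-1 y) ->
  porbit t x = porbit s x.
Proof.
move=> sA tA tNA.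
have sVA y : A (s^-1 y) = A y by rewrite -[in RHS](permKV s y) sA.
case: (boolP (A x)) => Ax; last rewrite -[RHS]porbitV.
- suff eq i : (t ^+ i) x = (s ^+ i) x /\ A ((s ^+ i) x).
    by apply/setP => y; apply/porbitP/porbitP => -[i ->]; exists i;
       case: (eq i).
  elim: i => [|i [IH Ai]]; first by rewrite !perm1.
  by rewrite !expgSr !permM IH sA tA.
- suff eq i : (t ^+ i) x = (s^-1 ^+ i) x /\ ~~ A ((s^-1 ^+ i) x).
    by apply/setP => y; apply/porbitP/porbitP => -[i ->]; exists i;
       case: (eq i).
  elim: i => [|i [IH Ai]]; first by rewrite !perm1.
  by rewrite !expgSr !permM IH sVA tNA.
Qed.

(* The involution h maps each orbit of h * v to a different orbit: otherwise a
   conjugate of h or v would have a fixed point. Colour one of each two. *)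
Lemma involutions_colouring h v (E : pred T) :
  involutive h -> involutive v ->
  (forall x, E x -> E (h x) /\ E (v x)) ->
  (forall x, E x -> h x != x /\ v x != x) ->
  exists c : T -> bool,
    forall x, E x -> c (h x) = ~~ c x /\ c (v x) = ~~ c x.
Proof.
move=> hK vK stabE freeE.
pose p := h * v.
have pE x : p x = v (h x) by rewrite permM.
(* [h] conjugates [p] to its inverse. *)
have hp_inv x : h (p (h (p x))) = x by rewrite !pE hK vK hK.
have hpX i x : h ((p ^+ i) (h ((p ^+ i) x))) = x.
  elim: i x => [|i IH] x; first by rewrite perm1 perm1 hK.
  have php z : p (h (p z)) = h z by rewrite -[LHS]hK hp_inv.
  have E1 y : (p ^+ i.+1) y = p ((p ^+ i) y) by rewrite expgSr permM.
  have E2 y : (p ^+ i.+1) y = (p ^+ i) (p y) by rewrite expgS permM.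
  by rewrite {1}E2 E1 php IH.
have EpX i x : E x -> E ((p ^+ i) x).
  elim: i => [|i IH] Ex; first by rewrite perm1.
  by rewrite expgSr permM pE; case: (stabE _ (IH Ex)) => /stabE[].
have ne_orb x : E x -> h x \notin porbit p x.
  move=> Ex; apply/porbitP => -[k hx].
  have Hk : h x = (p ^+ (k./2 + k./2)) (if odd k then p x else x).
    rewrite hx -{1}(odd_double_half k) -addnn expgD permM.
    by case: (odd k); rewrite ?expg1 ?expg0 ?perm1.
  (* As [h] inverts [p], halving the exponent gives [h y = y] for even [k] and [h y = p y = v (h y)]
     for odd [k]: a fixed point of [h] or of [v]. *)
  pose y := (p ^+ k./2) x; have Ey : E y := EpX _ _ Ex.
  have Hy : h y = (p ^+ k./2) (if odd k then p x else x).
    apply: (@perm_inj _ (p ^+ k./2)); rewrite -[RHS]permM -expgD -Hk.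
    by rewrite -[LHS]hK hpX.
  move: Hy; case: (odd k) => Hy; last by case/freeE: Ey; rewrite Hy eqxx.
  have : h y = p y by rewrite Hy -[LHS]permM -expgS expgSr permM.
  have [Ehy _] := stabE _ Ey; have [_] := freeE _ Ehy.
  by rewrite pE => /eqP ne eq; case: ne.
pose r x := enum_rank (porbit p x).
exists (fun x => r x < r (h x))%N => x Ex.
have lt_neq : (r (h x) < r x)%N = ~~ (r x < r (h x))%N.
  rewrite ltnNge leq_eqVlt negb_or; apply/andb_idl => _.
  apply: contraNneq (ne_orb x Ex) => /val_inj/enum_rank_inj eq_orb.
  by rewrite -eq_porbit_mem eq_orb.
(* Since [p (h x) = v x], the maps [h] and [v] send [x] into the same orbit of [p]. *)
have rv : r (v x) = r (h x).
  by rewrite /r -(porbit_perm p 1 (h x)) expg1 pE hK.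
have rhv : r (h (v x)) = r x.
  by rewrite /r -(porbit_perm p 1 (h (v x))) expg1 pE hK vK.
by rewrite hK rv rhv.
Qed.

End Permutations.

(** * Rank-two matrices as sums of two permutation matrices *)

Section Matrices.
Local Open Scope ring_scope.
Variable n : nat.
Implicit Types (M N : 'M[int]_n) (s t a b : 'S_n).

(** A single pair holds both positions, so that [fin_all_exists] can choose them for all rows or
    columns at once. *)
Lemma sum01_eq2 (T : finType) (f : T -> int) :
  (forall x, f x = 0 \/ f x = 1) -> \sum_x f x = 2 ->
  exists u : T * T, u.1 != u.2 /\
    forall x, f x = ((x == u.1) || (x == u.2))%:R.
Proof.
move=> f01 sum2; pose A := [set x | f x == 1]%SET.
have fA x : f x = (x \in A)%:R.
  by rewrite inE; case: (f01 x) => ->; rewrite ?eqxx.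
have : #|A| == 2.
  rewrite -(eqr_nat int) -sum2 (eq_bigr _ (fun x _ => fA x)) -natr_sum.
  by rewrite -big_mkcond sum1_card.
case/cards2P=> p [q [pq defA]]; exists (p, q); split=> // x.
by rewrite fA defA !inE.
Qed.

Lemma rank_two_sum_perm M : rank_two M ->
  exists a b, (forall i, a i != b i) /\ M = perm_mx a + perm_mx b.
Proof.
case=> -[M01 _] [rowM colM].
have /fin_all_exists[r rP] i := sum01_eq2 (M01 i) (rowM i).
have /fin_all_exists[c cP] j := sum01_eq2 (fun i => M01 i j) (colM j).
pose E (x : 'I_n * 'I_n) := M x.1 x.2 == 1.
have oneE (d : bool) : ((d%:R : int) == 1) = d by case: d.
have Er i j : E (i, j) = (j == (r i).1) || (j == (r i).2).
  by rewrite /E /= (proj2 (rP i)) oneE.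
have Ec i j : E (i, j) = (i == (c j).1) || (i == (c j).2).
  by rewrite /E /= (proj2 (cP j)) oneE.
(* Transpositions give involutions on all positions; zeros of [M] stay fixed, so freeness holds only
   on [E]. *)
pose h0 (x : 'I_n * 'I_n) := (x.1, tperm (r x.1).1 (r x.1).2 x.2).
pose v0 (x : 'I_n * 'I_n) := (tperm (c x.2).1 (c x.2).2 x.1, x.2).
have h0K : involutive h0 by case=> i j; rewrite /h0 /= tpermK.
have v0K : involutive v0 by case=> i j; rewrite /v0 /= tpermK.
pose h := perm (inv_inj h0K); pose v := perm (inv_inj v0K).
have [x|x|x|x|col colP] := @involutions_colouring _ h v E.
- by rewrite !permE h0K.
- by rewrite !permE v0K.
- case: x => i j Ex; rewrite !permE /h0 /v0 /= Er Ec; split.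
    by move: Ex; rewrite Er => /orP[]/eqP->; rewrite ?tpermL ?tpermR eqxx ?orbT.
  by move: Ex; rewrite Ec => /orP[]/eqP->; rewrite ?tpermL ?tpermR eqxx ?orbT.
- case: x => i j Ex; rewrite !permE /h0 /v0 /= !xpair_eqE !eqxx andbT /=; split.
    move: Ex; rewrite Er => /orP[]/eqP->; rewrite ?tpermL ?tpermR //.
      by rewrite eq_sym; case: (rP i).
    by case: (rP i).
  move: Ex; rewrite Ec => /orP[]/eqP->; rewrite ?tpermL ?tpermR //.
    by rewrite eq_sym; case: (cP j).
  by case: (cP j).
have col_r i : col (i, (r i).2) = ~~ col (i, (r i).1).
  have := colP (i, (r i).1); rewrite Er eqxx => /(_ isT)[<- _].
  by rewrite permE /h0 /= tpermL.
(* Each column has one entry of each colour; this makes [f d] below injective. *)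
have col_c i i' j : E (i, j) -> E (i', j) -> col (i, j) = col (i', j) -> i = i'.
  have H : col ((c j).2, j) = ~~ col ((c j).1, j).
    have := colP ((c j).1, j); rewrite Ec eqxx => /(_ isT)[_ <-].
    by rewrite permE /v0 /= tpermL.
  rewrite !Ec => /orP[]/eqP-> /orP[]/eqP-> //; rewrite H => /esym/eqP;
    by rewrite ?eqb_negLR -?addbT; case: (col _).
(* The column of the one of colour [d] in row [i]; the [else] branch is right because the two ones
   of a row differ in colour. *)
pose f d i := if col (i, (r i).1) == d then (r i).1 else (r i).2.
have fE d i : E (i, f d i) by rewrite Er /f; case: ifP; rewrite eqxx ?orbT.
have f_col d i : col (i, f d i) = d.
  by rewrite /f; case: eqP => // /eqP; rewrite col_r; case: (col _); case: d.
have f_inj d : injective (f d).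
  move=> i i' eq_f; apply: (@col_c _ _ (f d i)) => //; last first.
    by rewrite f_col [in RHS]eq_f f_col.
  by rewrite eq_f.
exists (perm (@f_inj true)), (perm (@f_inj false)).
have [rne _] := all_and2 rP.
split=> [i|].
  apply/eqP; rewrite !permE => eq_f.
  by have := f_col true i; rewrite eq_f f_col.
apply/matrixP => i j; rewrite !mxE !permE (proj2 (rP i)) /f.
have := rne i; rewrite ![_ == j]eq_sym.
case: (col _) => /=; case: (j =P (r i).1) => [->|_] /negPf /=.
- by move=> ->.
- by rewrite add0r.
- by move=> ->.
- by rewrite addr0.
Qed.

Lemma IplusP_rank_two s : derangement s -> rank_two (IplusP s).
Proof.
move=> ds; have ls : has_line_sum (IplusP s) 2.
  have perm_sums t : (forall i, \sum_j (perm_mx t : 'M[int]_n) i j = 1) /\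
                     (forall j, \sum_i (perm_mx t : 'M[int]_n) i j = 1).
    split=> [i|j].
      rewrite (bigD1 (t i)) //= big1 => [|j]; rewrite !mxE ?eqxx ?addr0 //.
      by rewrite eq_sym => /negPf->.
    rewrite (bigD1 (t^-1 j)%g) //= big1 => [|i]; rewrite !mxE ?permKV ?eqxx //.
    by move=> ne; case: eqP => // eq_j; rewrite -eq_j permK eqxx in ne.
  rewrite /IplusP -perm_mx1; split=> i.
    under eq_bigr do rewrite mxE.
    by rewrite big_split /= !(proj1 (perm_sums _)).
  under eq_bigr do rewrite mxE.
  by rewrite big_split /= !(proj2 (perm_sums _)).
split=> //; split; last by exists 2.
move=> i j; rewrite !mxE; case: (i =P j) => [<-|_].
  by move/eqP/negPf: (ds i) => ->; right.
by case: eqP => _; [right | left].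
Qed.

(** * The action of [G] on matrices *)

Lemma invmx_perm t : invmx (perm_mx t : 'M[int]_n) = perm_mx t^-1.
Proof.
by rewrite -[LHS]mulmx1 -perm_mx1 -(mulgV t) perm_mxM mulKmx ?unitmx_perm.
Qed.

Lemma line_transf_comp s t s' t' M :
  line_transf s t (line_transf s' t' M) = line_transf (s * s') (t * t') M.
Proof.
by rewrite /line_transf !invmx_perm invMg !perm_mxM !mulmxA.
Qed.

(** This lets a transpose be moved past row and column permutations, for inverses and composites in
    [G]. *)
Lemma trmx_line_transf s t M : (line_transf s t M)^T = line_transf t s M^T.
Proof.
by rewrite /line_transf !trmx_mul !invmx_perm !tr_perm_mx invgK mulmxA.
Qed.

Lemma GorbitP M N : Gorbit M N <->
  exists s t, N = line_transf s t M \/ N = line_transf s t M^T.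
Proof.
split=> [[_ [s [t [] ->]] <-]|[s [t [] ->]]]; try by exists s, t; auto.
  by exists (line_transf s t) => //; exists s, t; left.
by exists (line_transf_tr s t) => //; exists s, t; right.
Qed.

Lemma line_transfK s t : cancel (@line_transf n s t) (line_transf s^-1 t^-1).
Proof.
move=> M; rewrite line_transf_comp !mulVg /line_transf invmx_perm invg1.
by rewrite perm_mx1 mulmx1 mul1mx.
Qed.

Lemma Gorbit_refl M : Gorbit M M.
Proof.
apply/GorbitP; exists 1%g, 1%g; left.
by rewrite /line_transf invmx_perm invg1 perm_mx1 mulmx1 mul1mx.
Qed.

Lemma Gorbit_sym M N : Gorbit M N -> Gorbit N M.
Proof.
case/GorbitP=> s [t [->|->]]; apply/GorbitP.
  by exists s^-1%g, t^-1%g; left; rewrite line_transfK.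
exists t^-1%g, s^-1%g; right.
by rewrite trmx_line_transf trmxK line_transfK.
Qed.

Lemma Gorbit_trans M N K : Gorbit M N -> Gorbit N K -> Gorbit M K.
Proof.
case/GorbitP=> s [t MN] /GorbitP[s' [t' NK]]; apply/GorbitP.
case: MN NK => -> [] ->; rewrite ?trmx_line_transf ?trmxK !line_transf_comp;
  by do 2 eexists; auto.
Qed.

Lemma Gorbit_eqP M N : Gorbit M = Gorbit N <-> Gorbit M N.
Proof.
split=> [->|MN]; first exact: Gorbit_refl.
apply/seteqP; split=> K; apply: Gorbit_trans => //.
exact: Gorbit_sym.
Qed.

(** * Orbits of the matrices [IplusP s] *)

Lemma sum_perm_IplusP a b :
  perm_mx a + perm_mx b = line_transf a 1 (IplusP (a^-1 * b)).
Proof.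
rewrite /line_transf invmx_perm invg1 perm_mx1 mulmx1 /IplusP mulmxDr mulmx1.
by rewrite -perm_mxM mulKVg.
Qed.

(** For the two summands [perm_mx a] and [perm_mx b], the quotient [a^-1 * b] is [t * u * t^-1], a
    conjugate of [u]. *)
Lemma line_transf_IplusP s t u :
  line_transf s t (IplusP u) = perm_mx (s * t^-1) + perm_mx (s * u * t^-1).
Proof.
rewrite /line_transf invmx_perm /IplusP mulmxDr mulmx1 mulmxDl.
by rewrite !perm_mxM.
Qed.

Lemma trmx_IplusP s : (IplusP s)^T = IplusP s^-1.
Proof. by rewrite /IplusP linearD /= trmx1 tr_perm_mx. Qed.

(** A permutation and its inverse have the same orbits. Hence transposing [IplusP s] does not change
    the class. *)
Lemma conj_classV s : s^-1%g \in conj_class s.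
Proof. by apply: eq_porbit_conjg => x; rewrite porbitV. Qed.

(* Row i forces {a i, b i} = {i, s i}. The rows with a i = i form a union of
   cycles of s, on which a^-1 * b agrees with s; it agrees with s^-1 on the
   remaining cycles. *)
Lemma IplusP_sum_perm_conj s a b : derangement s ->
  IplusP s = perm_mx a + perm_mx b -> (a^-1 * b)%g \in conj_class s.
Proof.
move=> ds eq_sum.
have ab i : (a i = i /\ b i = s i) \/ (a i = s i /\ b i = i).
  have entry j : ((i == j)%:R + (s i == j)%:R : int) =
                 (a i == j)%:R + (b i == j)%:R.
    by have := congr1 (fun M : 'M_n => M i j) eq_sum; rewrite !mxE.
  have dsi : (s i == i) = false by apply/eqP.
  have := entry i; have := entry (s i); rewrite !eqxx [i == s i]eq_sym dsi.
  case: (a i =P i) => [->|_]; case: (b i =P i) => [->|_];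
    rewrite ?[i == s i]eq_sym ?dsi //; case: eqP => // -> _; auto.
pose A i := a i == i.
(* If [a] fixed exactly one of [i] and [s i], then [a] or [b] would take the value [s i] at both. *)
have AsE i : A (s i) = A i.
  apply/idP/idP => /eqP eA.
    case: (ab i) => -[ai _]; first by apply/eqP.
    by case: (ds i); apply: (@perm_inj _ a); rewrite eA ai.
  case: (ab (s i)) => -[asi bsi]; first by apply/eqP.
  case: (ab i) => -[ai bi]; last by case: (ds i); rewrite -ai eA.
  by case: (ds i); apply: (@perm_inj _ b); rewrite bsi bi.
apply: eq_porbit_conjg => x; apply/esym.
apply: (@porbit_eq_or_inv _ _ _ _ A) => // y; rewrite permM => Ay.
- have ay : (a^-1 y)%g = y by rewrite -[in LHS](eqP Ay) permK.
  rewrite ay; case: (ab y) => -[ay' by'] //.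
  by move: Ay; rewrite /A ay' => /eqP/ds.
(* At [z = s^-1 y], [a] sends [z] to [y] and [b] fixes [z]. *)
- have Az : ~~ A (s^-1 y)%g by rewrite -AsE permKV.
  case: (ab (s^-1 y)%g) => -[az bz]; first by rewrite /A az eqxx in Az.
  by rewrite permKV in az; rewrite -[X in b (_ X)]az permK bz.
Qed.

Lemma Gorbit_IplusP s t : derangement s -> derangement t ->
  Gorbit (IplusP s) (IplusP t) <-> t \in conj_class s.
Proof.
move=> ds dt; split.
  (* Applied with [u = s], or with [u = s^-1] when the transformation transposes. *)
  suff conj u v w : IplusP t = line_transf v w (IplusP u) ->
      conj_class u = conj_class t.
    case/GorbitP=> v [w []]; rewrite ?trmx_IplusP => /conj eq_c.
      by apply/class_eqP; rewrite -/(conj_class t) -eq_c.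
    apply/class_eqP; rewrite -/(conj_class t) -eq_c.
    by apply/class_eqP; apply: conj_classV.
  rewrite line_transf_IplusP => /(IplusP_sum_perm_conj dt)/class_eqP.
  rewrite -/(conj_class t) => <-; rewrite -!mulgA invMg invgK -mulgA mulKg.
  by apply/esym/class_eqP/imsetP; exists w^-1%g; rewrite ?inE // conjgE invgK.
(* Permuting rows and columns alike keeps the identity and conjugates [s]. *)
case/imsetP=> u _ ->; apply/GorbitP; exists u^-1%g, u^-1%g; left.
by rewrite line_transf_IplusP invgK mulVg perm_mx1 conjgE mulgA.
Qed.

Lemma rank_two_IplusP M : rank_two M ->
  exists s, derangement s /\ Gorbit (IplusP s) M.
Proof.
case/rank_two_sum_perm=> a [b [ab ->]]; exists (a^-1 * b)%g; split.
  move=> i; rewrite permM -[X in _ <> X](permKV a i) => /eqP.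
  by rewrite eq_sym; apply/negP.
by apply/GorbitP; exists a, 1%g; left; apply: sum_perm_IplusP.
Qed.

End Matrices.

Theorem theorem4p4 (n : nat) :
  (exists f : {set 'S_n} -> set 'M[int]_n,
     set_bij (@derangement_classes n) (@rank_two_orbits n) f /\
     (forall s : 'S_n, derangement s ->
        f (conj_class s) = Gorbit (IplusP s))) /\
  (forall M : 'M[int]_n, rank_two M ->
     exists s : 'S_n, derangement s /\ Gorbit (IplusP s) M) /\
  (forall s t : 'S_n, derangement s -> derangement t ->
     (Gorbit (IplusP s) (IplusP t) <-> t \in conj_class s)).
Proof.
split; last by split; [exact: rank_two_IplusP | exact: Gorbit_IplusP].
(* The union of the orbits over all derangements in [C] avoids choosing a representative; [fE] shows
   that they coincide. *)
pose f (C : {set 'S_n}) : set 'M[int]_n := fun N =>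
  exists s : 'S_n, [/\ derangement s, conj_class s = C & Gorbit (IplusP s) N].
have fE (s : 'S_n) : derangement s -> f (conj_class s) = Gorbit (IplusP s).
  move=> ds; apply/seteqP; split=> N; last by exists s.
  case=> t [dt /esym/class_eqP s_t tN].
  apply: Gorbit_trans tN; apply/Gorbit_sym.
  by apply/Gorbit_IplusP.
exists f; split=> //; split.
- move=> _ [s ds <-]; rewrite fE //.
  by exists (IplusP s) => //; exact: IplusP_rank_two.
- move=> C D /set_mem[s ds <-] /set_mem[t dt <-]; rewrite !fE // => /Gorbit_eqP.
  by move/(Gorbit_IplusP ds dt)/class_eqP/esym.
- move=> _ [M /rank_two_IplusP[s [ds sM]] <-].
  exists (conj_class s); first by exists s.
  by rewrite fE //; apply/Gorbit_eqP.
Qed.
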